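(* Let $\mathcal H$ be an infinite-dimensional complex Hilbert space, let $\mathbf A=(A_1,\dots,A_m)\in\mathcal S(\mathcal H)^m$, let $n\ge1$ be an integer and let $\mathbf F_0\in\mathcal S(\mathcal H)^m\cap\mathcal F(\mathcal H)^m$. Then the following sets are equal: (a) $\Lambda_\infty(\mathbf A)$; (b) $\Lambda_\infty(\mathbf A+\mathbf F_0)$; (c) $\bigcap\{\Lambda_n(\mathbf A+\mathbf F):\ \mathbf F\in\mathcal F(\mathcal H)^m\cap\mathcal S(\mathcal H)^m\}$; (d) $\bigcap_{k\ge1}\big(\bigcap\{\Lambda_k(\mathbf A+\mathbf F):\ \mathbf F\in\mathcal F(\mathcal H)^m\cap\mathcal S(\mathcal H)^m\}\big)$.
   Context: $\mathcal S(\mathcal H)$ is the set of bounded self-adjoint operators on $\mathcal H$ and $\mathcal F(\mathcal H)$ the set of finite-rank operators; for $\mathbf F=(F_1,\dots,F_m)$, $\mathbf A+\mathbf F=(A_1+F_1,\dots,A_m+F_m)$. For a positive integer $k$, $\Lambda_k(\mathbf A)=\{(a_1,\dots,a_m)\in\mathbb R^m:$ there is an orthogonal projection $P$ of rank $k$ on $\mathcal H$ with $PA_jP=a_jP$ for all $j\}$; $\Lambda_\infty(\mathbf A)$ is defined the same way with $P$ of infinite rank. *)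

(* Defs.v *)
From HB Require Import structures.
From mathcomp Require Import all_boot all_order all_algebra.
From mathcomp Require Import reals.
From mathcomp.real_closed Require Import complex.

Set Implicit Arguments.
Unset Strict Implicit.
Unset Printing Implicit Defensive.

Import Order.TTheory GRing.Theory Num.Theory.
Local Open Scope ring_scope.

Record inner_product (R : realType) (V : lmodType R[i]) := InnerProduct {
  inner :> V -> V -> R[i];
  inner_linear_l : forall (a : R[i]) (x y z : V),
      inner (a *: x + y) z = a * inner x z + inner y z;
  inner_conj_sym : forall x y : V, inner y x = Num.conj (inner x y);
  inner_pos_def : forall x : V, x != 0 -> 0 < inner x x
}.

Section Hilbert.
Variables (R : realType) (V : lmodType R[i]) (ip : inner_product V).

Definition hnorm (x : V) : R := Num.sqrt (complex.Re (ip x x)).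

Definition hcomplete : Prop :=
  forall u : nat -> V,
    (forall e : R, 0 < e -> exists N : nat, forall p q : nat,
        (N <= p)%N -> (N <= q)%N -> hnorm (u p - u q) < e) ->
    exists l : V, forall e : R, 0 < e -> exists N : nat, forall p : nat,
        (N <= p)%N -> hnorm (u p - l) < e.

Definition in_span (s : seq V) (x : V) : Prop :=
  exists c : seq R[i], x = \sum_(i < size s) c`_i *: s`_i.

Definition infinite_dim : Prop :=
  forall s : seq V, exists x : V, ~ in_span s x.

Definition bounded_sa (T : V -> V) : Prop :=
  [/\ forall (a : R[i]) (x y : V), T (a *: x + y) = a *: T x + T y,
      exists M : R, forall x : V, hnorm (T x) <= M * hnorm x
    & forall x y : V, ip (T x) y = ip x (T y)].

Definition finite_rank (T : V -> V) : Prop :=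
  exists s : seq V, forall x : V, in_span s (T x).

Definition orth_proj (P : V -> V) : Prop :=
  bounded_sa P /\ forall x : V, P (P x) = P x.

Definition range_dim (P : V -> V) (k : nat) : Prop :=
  exists e : seq V, [/\ size e = k,
    forall i j : nat, (i < k)%N -> (j < k)%N ->
      ip e`_i e`_j = (i == j)%:R,
    forall i : nat, (i < k)%N -> P e`_i = e`_i
    & forall x : V, in_span e (P x)].

Definition infinite_range (P : V -> V) : Prop :=
  forall s : seq V, exists x : V, ~ in_span s (P x).

Definition compression (m : nat) (A : 'I_m -> V -> V) (P : V -> V)
    (a : 'I_m -> R) : Prop :=
  forall (j : 'I_m) (x : V), P (A j (P x)) = ((a j)%:C)%C *: P x.

Definition Lambda (m k : nat) (A : 'I_m -> V -> V) (a : 'I_m -> R) : Prop :=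
  exists P : V -> V, [/\ orth_proj P, range_dim P k & compression A P a].

Definition Lambda_inf (m : nat) (A : 'I_m -> V -> V) (a : 'I_m -> R) : Prop :=
  exists P : V -> V, [/\ orth_proj P, infinite_range P & compression A P a].

Definition tuple_add (m : nat) (A F : 'I_m -> V -> V) : 'I_m -> V -> V :=
  fun j x => A j x + F j x.

Definition sa_finite_rank_tuple (m : nat) (F : 'I_m -> V -> V) : Prop :=
  forall j : 'I_m, bounded_sa (F j) /\ finite_rank (F j).

End Hilbert.

Arguments hnorm {R V} ip x.
Arguments hcomplete {R V} ip.
Arguments in_span {R V} s x.
Arguments infinite_dim {R} V.
Arguments bounded_sa {R V} ip T.
Arguments finite_rank {R V} T.
Arguments orth_proj {R V} ip P.
Arguments range_dim {R V} ip P k.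
Arguments infinite_range {R V} P.
Arguments compression {R V m} A P a.
Arguments Lambda {R V} ip {m} k A a.
Arguments Lambda_inf {R V} ip {m} A a.
Arguments tuple_add {R V m} A F j x.
Arguments sa_finite_rank_tuple {R V} ip {m} F.

(* Main.v *)
(* The key point is that a lies in the joint numerical range of the compression
   of A to the complement of any finite-dimensional subspace W. Perturbing A by
   finite rank so that it becomes the compression plus a scalar a - d on W, the
   hypothesis gives a vector orthogonal to W whose value lies on the ray from a
   in direction d. Doing this for the m + 1 directions e_1, ..., e_m and
   -(1, ..., 1), each time enlarging W by the vector x found and by the A_j x,
   and adding up suitably rescaled vectors, the displacements cancel and the
   value is exactly a. Iterating produces an orthonormal sequence (x_i) with
   <A_j x_i, x_k> = a_j delta_ik, and the projection onto its closed span
   witnesses that a is in Lambda_inf(A). Conversely, removing finitely many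
   directions from the range of an infinite-rank projection makes any given
   finite-rank perturbation vanish on it. *)

Require Import Defs.
From HB Require Import structures.
From mathcomp Require Import all_boot all_order all_algebra.
From mathcomp Require Import ring.
From mathcomp Require Import boolp classical_sets reals.
From mathcomp.real_closed Require Import complex.
Import Order.TTheory GRing.Theory Num.Theory.
Local Open Scope ring_scope.
Set Implicit Arguments.
Unset Strict Implicit.
Unset Printing Implicit Defensive.

Section InnerProduct.
Variables (R : realType) (V : lmodType R[i]) (ip : inner_product V).
Implicit Types (x y z : V) (s w : seq V) (T P : V -> V).

(** * Inner products, Cauchy-Schwarz and squared norms *)

Lemma ipDl x y z : ip (x + y) z = ip x z + ip y z.
Proof. by have := inner_linear_l ip 1 x y z; rewrite scale1r mul1r. Qed.

Lemma ip0l z : ip 0 z = 0.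
Proof. by apply: (addrI (ip 0 z)); rewrite -ipDl !addr0. Qed.

Lemma ipZl a x z : ip (a *: x) z = a * ip x z.
Proof. by have := inner_linear_l ip a x 0 z; rewrite ip0l !addr0. Qed.

Lemma ipNl x z : ip (- x) z = - ip x z.
Proof. by rewrite -scaleN1r ipZl mulN1r. Qed.

Lemma ipBl x y z : ip (x - y) z = ip x z - ip y z.
Proof. by rewrite ipDl ipNl. Qed.

Lemma ip_suml (I : Type) (r : seq I) (f : I -> V) z :
  ip (\sum_(i <- r) f i) z = \sum_(i <- r) ip (f i) z.
Proof. exact: (big_morph (ip^~ z) (fun x y => ipDl x y z) (ip0l z)). Qed.

Lemma ipDr x y z : ip x (y + z) = ip x y + ip x z.
Proof. by rewrite inner_conj_sym ipDl rmorphD /= -!inner_conj_sym. Qed.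

Lemma ip0r z : ip z 0 = 0.
Proof. by rewrite inner_conj_sym ip0l rmorph0. Qed.

Lemma ipZr a x z : ip x (a *: z) = a^* * ip x z.
Proof. by rewrite inner_conj_sym ipZl rmorphM /= -inner_conj_sym. Qed.

Lemma ipNr x z : ip x (- z) = - ip x z.
Proof. by rewrite inner_conj_sym ipNl rmorphN /= -inner_conj_sym. Qed.

Lemma ipBr x y z : ip x (y - z) = ip x y - ip x z.
Proof. by rewrite ipDr ipNr. Qed.

Lemma ip_sumr (I : Type) (r : seq I) (f : I -> V) x :
  ip x (\sum_(i <- r) f i) = \sum_(i <- r) ip x (f i).
Proof. exact: (big_morph (ip x) (ipDr x) (ip0r x)). Qed.

Lemma ip_eq0C x y : ip x y = 0 -> ip y x = 0.
Proof. by move=> h; rewrite inner_conj_sym h rmorph0. Qed.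

Lemma ip_ge0 x : 0 <= ip x x.
Proof.
by have [->|/inner_pos_def-/(_ ip)/ltW//] := eqVneq x 0; rewrite ip0l.
Qed.

Lemma ip_eq0 x : ip x x = 0 -> x = 0.
Proof.
move=> h; apply/eqP/negPn/negP => /inner_pos_def-/(_ ip).
by rewrite h ltxx.
Qed.

Lemma ip_orth_add x y : ip x y = 0 -> ip (x + y) (x + y) = ip x x + ip y y.
Proof.
by move=> h; rewrite ipDl !ipDr h (ip_eq0C h) addr0 add0r.
Qed.

(** Pythagoras for [x - c *: y] and [c *: y], with [c] chosen to make the first orthogonal to [y];
    the bound is what remains after dropping the first square. *)
Lemma cauchy_schwarz x y : `|ip x y| ^+ 2 <= ip x x * ip y y.
Proof.
have [->|y0] := eqVneq y 0; first by rewrite !ip0r normr0 expr0n mulr0.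
have yy : 0 < ip y y by exact: inner_pos_def.
have [c ck] : exists c, c * ip y y = ip x y.
  by exists (ip x y / ip y y); rewrite divfK// gt_eqF.
have ckJ : c^* * ip y y = (ip x y)^*.
  by rewrite -ck rmorphM /= -inner_conj_sym.
have := ip_orth_add (x := x - c *: y) (y := c *: y).
rewrite subrK => ->; last by rewrite ipZr ipBl ipZl ck subrr mulr0.
rewrite mulrDl ler_wpDl ?mulr_ge0 ?ip_ge0//.
by rewrite ipZl ipZr ckJ mulrAC ck normCK.
Qed.

Definition sqnorm x : R := complex.Re (ip x x).

Lemma sqnormE x : ip x x = ((sqnorm x)%:C)%C.
Proof. by rewrite /sqnorm RRe_real// ger0_real// ip_ge0. Qed.

Lemma sqnorm_ge0 x : 0 <= sqnorm x.
Proof. by rewrite -ler0c -sqnormE ip_ge0. Qed.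

Lemma sqr_hnorm x : hnorm ip x ^+ 2 = sqnorm x.
Proof. by rewrite sqr_sqrtr// sqnorm_ge0. Qed.

Lemma hnorm_lt x (e : R) : 0 < e -> (hnorm ip x < e) = (sqnorm x < e ^+ 2).
Proof.
by move=> e0; rewrite -sqr_hnorm ltr_pXn2r// nnegrE ?sqrtr_ge0 ?ltW.
Qed.

(** Parallelogram law: the two sides differ by the square of [x - y]. *)
Lemma sqnormD_le x y : sqnorm (x + y) <= (sqnorm x + sqnorm y) *+ 2.
Proof.
rewrite -lecR -subr_ge0.
suff -> : (((sqnorm x + sqnorm y) *+ 2)%:C - (sqnorm (x + y))%:C)%C
          = ip (x - y) (x - y) by exact: ip_ge0.
rewrite rmorphMn rmorphD /= -!sqnormE !(ipDl, ipDr, ipNl, ipNr); ring.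
Qed.

(** * Linear maps and spans of finite sequences *)

Definition lin T := forall (a : R[i]) x y, T (a *: x + y) = a *: T x + T y.

Lemma linD T : lin T -> forall x y, T (x + y) = T x + T y.
Proof. by move=> h x y; have := h 1 x y; rewrite !scale1r. Qed.

Lemma lin0 T : lin T -> T 0 = 0.
Proof. by move=> h; apply: (addrI (T 0)); rewrite -(linD h) !addr0. Qed.

Lemma linZ T : lin T -> forall a x, T (a *: x) = a *: T x.
Proof. by move=> h a x; have := h a x 0; rewrite (lin0 h) !addr0. Qed.

Lemma linN T : lin T -> forall x, T (- x) = - T x.
Proof. by move=> h x; rewrite -scaleN1r (linZ h) scaleN1r. Qed.

Lemma linB T : lin T -> forall x y, T (x - y) = T x - T y.
Proof. by move=> h x y; rewrite (linD h) (linN h). Qed.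

Lemma lin_sum T (I : Type) (r : seq I) (f : I -> V) : lin T ->
  T (\sum_(i <- r) f i) = \sum_(i <- r) T (f i).
Proof. by move=> h; apply: (big_morph T (linD h) (lin0 h)). Qed.

Lemma lin_add S T : lin S -> lin T -> lin (fun x => S x + T x).
Proof. by move=> lS lT a x y; rewrite lS lT scalerDr addrACA. Qed.

Lemma lin_opp T : lin T -> lin (fun x => - T x).
Proof. by move=> lT a x y; rewrite lT scalerN opprD. Qed.

Lemma lin_scale c T : lin T -> lin (fun x => c *: T x).
Proof. by move=> lT a x y; rewrite lT scalerDr !scalerA mulrC. Qed.

(** Coefficient functions combine pointwise, unlike sequences whose lengths may differ. *)
Lemma in_spanP s x :
  in_span s x <-> exists f : nat -> R[i], x = \sum_(i < size s) f i *: s`_i.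
Proof.
split=> [[c ->]|[f ->]]; first by exists (nth 0 c).
exists (mkseq f (size s)); apply: eq_bigr => i _.
by rewrite nth_mkseq.
Qed.

Lemma in_span_lin s a x y :
  in_span s x -> in_span s y -> in_span s (a *: x + y).
Proof.
move=> /in_spanP[f ->] /in_spanP[g ->]; apply/in_spanP.
exists (fun i => a * f i + g i); rewrite scaler_sumr -big_split /=.
by apply: eq_bigr => i _; rewrite scalerDl scalerA.
Qed.

Lemma in_span0 s : in_span s 0.
Proof.
apply/in_spanP; exists (fun=> 0); rewrite big1// => i _.
by rewrite scale0r.
Qed.

Lemma in_spanZ s a x : in_span s x -> in_span s (a *: x).
Proof. by move=> h; rewrite -[_ *: _]addr0; apply/in_span_lin/in_span0. Qed.

Lemma in_spanD s x y : in_span s x -> in_span s y -> in_span s (x + y).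
Proof. by move=> hx hy; rewrite -[x]scale1r; apply: in_span_lin. Qed.

Lemma in_span_sum s (I : eqType) (r : seq I) (f : I -> V) :
  (forall i, i \in r -> in_span s (f i)) -> in_span s (\sum_(i <- r) f i).
Proof.
move=> h; rewrite big_seq; apply: big_ind => //; first exact: in_span0.
exact: in_spanD.
Qed.

Lemma in_span_mem s x : x \in s -> in_span s x.
Proof.
move=> xs; apply/in_spanP; exists (fun i => (i == index x s)%:R).
have xi : (index x s < size s)%N by rewrite index_mem.
rewrite (bigD1 (Ordinal xi))//= eqxx scale1r nth_index// big1 ?addr0// => i.
by rewrite -val_eqE /= => /negbTE ->; rewrite scale0r.
Qed.

Lemma in_span_trans s w x :
  (forall y, y \in s -> in_span w y) -> in_span s x -> in_span w x.
Proof.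
move=> h [c ->]; rewrite -(big_mkord xpredT (fun i => c`_i *: s`_i)).
apply: in_span_sum => i; rewrite mem_index_iota => /andP[_ i_s].
by apply/in_spanZ/h/mem_nth.
Qed.

Lemma in_span_catl s w x : in_span s x -> in_span (s ++ w) x.
Proof.
by apply: in_span_trans => y ys; apply: in_span_mem; rewrite mem_cat ys.
Qed.

Lemma in_span_catr s w x : in_span w x -> in_span (s ++ w) x.
Proof.
by apply: in_span_trans => y ys; apply: in_span_mem; rewrite mem_cat ys orbT.
Qed.

Lemma ip_span0 s x y :
  (forall z, z \in s -> ip x z = 0) -> in_span s y -> ip x y = 0.
Proof.
move=> h [c ->]; rewrite ip_sumr big1// => i _.
by rewrite ipZr h ?mulr0// mem_nth.
Qed.

(** * Finite orthonormal families and projections onto their spans *)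

Definition orthonormal w :=
  uniq w /\ forall u v, u \in w -> v \in w -> ip u v = (u == v)%:R.

Definition pr w x := \sum_(v <- w) ip x v *: v.

Lemma pr_lin w : lin (pr w).
Proof.
move=> a x y; rewrite /pr scaler_sumr -big_split /=.
by apply: eq_bigr => v _; rewrite ipDl ipZl scalerDl scalerA.
Qed.

Lemma pr_sym w x y : ip (pr w x) y = ip x (pr w y).
Proof.
rewrite /pr ip_suml ip_sumr; apply: eq_bigr => v _.
by rewrite ipZl ipZr -inner_conj_sym mulrC.
Qed.

Lemma pr_in_span w x : in_span w (pr w x).
Proof.
by apply: in_span_sum => v vw; apply/in_spanZ/in_span_mem.
Qed.

Lemma pr_mem w u : orthonormal w -> u \in w -> pr w u = u.
Proof.
move=> [uw ow] hu; rewrite /pr (bigD1_seq u)//= big_seq_cond big1 ?addr0.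
  by rewrite ow// eqxx scale1r.
by move=> v /andP[vw vu]; rewrite ow// eq_sym (negbTE vu) scale0r.
Qed.

Lemma pr_id w x : orthonormal w -> pr w (pr w x) = pr w x.
Proof.
move=> ow; rewrite {2 3}/pr (lin_sum _ _ (@pr_lin w)).
rewrite big_seq [RHS]big_seq; apply: eq_bigr => v vw.
by rewrite (linZ (@pr_lin w)) pr_mem.
Qed.

Lemma pr_span w x : orthonormal w -> in_span w x -> pr w x = x.
Proof.
move=> ow [c ->]; rewrite (lin_sum _ _ (@pr_lin w)).
by apply: eq_bigr => i _; rewrite (linZ (@pr_lin w)) pr_mem ?mem_nth.
Qed.

Lemma pr_residual_orth w x v :
  orthonormal w -> v \in w -> ip (x - pr w x) v = 0.
Proof. by move=> ow vw; rewrite ipBl pr_sym pr_mem// subrr. Qed.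

Lemma normalize x : x != 0 ->
  exists c : R[i], c != 0 /\ c * c^* * ip x x = 1.
Proof.
move=> x0; have xx : 0 < ip x x by exact: inner_pos_def.
have c0 : 0 < (sqrtC (ip x x))^-1 by rewrite invr_gt0 sqrtC_gt0.
exists (sqrtC (ip x x))^-1; split; first by rewrite gt_eqF.
rewrite conj_Creal ?ger0_real ?ltW// -expr2 exprVn sqrtCK mulVf//.
by rewrite gt_eqF.
Qed.

Lemma orthonormal_extend w y : orthonormal w -> y != 0 ->
  (forall v, v \in w -> ip y v = 0) ->
  exists2 c : R[i], c != 0 & orthonormal (c *: y :: w).
Proof.
move=> [uw ow] y0 yw; have [c [c0 cy]] := normalize y0.
have ew v : v \in w -> ip (c *: y) v = 0 by move=> /yw h; rewrite ipZl h mulr0.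
have ee : ip (c *: y) (c *: y) = 1 by rewrite ipZl ipZr mulrA.
have new : c *: y \notin w.
  by apply/negP => /ew/eqP; rewrite ee oner_eq0.
exists c => //; split=> /=; first by rewrite new.
move=> u v; rewrite !inE => /predU1P[->|hu] /predU1P[->|hv].
- by rewrite eqxx.
- by rewrite ew//; case: eqP => // h; rewrite h hv in new.
- by rewrite (ip_eq0C (ew _ hu)); case: eqP => // h; rewrite -h hu in new.
- exact: ow.
Qed.

(** Carrying [T] along keeps the new basis among its fixed points: with a projection for [T] the
    basis stays in the range, and [T = id] gives the usual statement. *)
Lemma gram_schmidt T s : lin T -> (forall x, x \in s -> T x = x) ->
  exists w, [/\ orthonormal w, forall v, v \in w -> T v = v
             & forall x, x \in s -> in_span w x].
Proof.
move=> hT; elim: s => [_|x s IH sT]; first by exists [::]; split.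
have [z zs|w [ow wT ws]] := IH; first by apply: sT; rewrite inE zs orbT.
have pT : T (pr w x) = pr w x.
  rewrite (lin_sum _ _ hT) big_seq [RHS]big_seq; apply: eq_bigr => v vw.
  by rewrite (linZ hT) wT.
have [y0|y0] := eqVneq (x - pr w x) 0.
  exists w; split=> // z; rewrite inE => /predU1P[->|/ws//].
  by rewrite (subr0_eq y0); exact: pr_in_span.
have [c c0 oe] :=
  orthonormal_extend ow y0 (fun v => @pr_residual_orth w x v ow).
exists (c *: (x - pr w x) :: w); split=> //.
- move=> v; rewrite inE => /predU1P[->|/wT//].
  by rewrite (linZ hT) (linB hT) pT sT// mem_head.
- move=> z; rewrite inE => /predU1P[->|/ws].
  + rewrite -[X in in_span _ X](subrK (pr w x)); apply: in_spanD.
      rewrite -[X in in_span _ X]scale1r -(mulVf c0) -scalerA.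
      by apply/in_spanZ/in_span_mem/mem_head.
    by rewrite -cat1s; apply/in_span_catr/pr_in_span.
  + by rewrite -cat1s; apply: in_span_catr.
Qed.

(** The coordinates of [w] in [s], times the inner products of [s] with [w], give the identity
    matrix of size [size w], which thus factors through dimension [size s]. *)
Lemma orthonormal_size_le w s : orthonormal w ->
  (forall v, v \in w -> in_span s v) -> (size w <= size s)%N.
Proof.
move=> [uw ow] ws.
have /fin_all_exists[c hc] (i : 'I_(size w)) : in_span s w`_i.
  by apply/ws/mem_nth.
pose C := \matrix_(i < size w, j < size s) (c i)`_j.
pose D := \matrix_(j < size s, i < size w) ip s`_j w`_i.
apply: (@mulmx1_min _ _ _ C D); apply/matrixP => i k; rewrite !mxE.
transitivity (ip w`_i w`_k).
  rewrite [in RHS]hc ip_suml; apply: eq_bigr => j _.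
  by rewrite !mxE ipZl.
by rewrite ow ?mem_nth// nth_uniq.
Qed.

(** * Bounded symmetric operators and orthogonal projections *)

Definition symm T := forall x y, ip (T x) y = ip x (T y).

(** Squared norms and a nonnegative constant let bounds be added and multiplied without square
    roots. *)
Definition bnd T :=
  exists2 M : R, 0 <= M & forall x, sqnorm (T x) <= M * sqnorm x.

Lemma bounded_saP T : bounded_sa ip T <-> [/\ lin T, bnd T & symm T].
Proof.
split=> [[l [M hM] s]|[l [M M0 hM] s]]; split=> //.
  exists (M ^+ 2) => [|x]; first exact: sqr_ge0.
  rewrite -!sqr_hnorm -exprMn ler_pXn2r ?nnegrE ?sqrtr_ge0//.
  by apply: le_trans (hM x); exact: sqrtr_ge0.
exists (Num.sqrt M) => x.
rewrite -(ler_pXn2r (n := 2))// ?nnegrE ?mulr_ge0 ?sqrtr_ge0//.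
by rewrite exprMn !sqr_hnorm sqr_sqrtr.
Qed.

Lemma bndD S T : bnd S -> bnd T -> bnd (fun x => S x + T x).
Proof.
move=> [M M0 hM] [N N0 hN]; exists ((M + N) *+ 2) => [|x].
  by rewrite mulrn_wge0// addr_ge0.
rewrite (le_trans (sqnormD_le _ _))// mulrnAl lerMn2r/= mulrDl.
by rewrite lerD.
Qed.

Lemma sqnormZ a x : sqnorm (a *: x) = complex.Re (a * a^* ) * sqnorm x.
Proof.
apply/(fmorph_inj (@real_complex R)); rewrite rmorphM /= -!sqnormE.
by rewrite ipZl ipZr mulrA RRe_real// ger0_real// mul_conjC_ge0.
Qed.

Lemma bndZ a T : bnd T -> bnd (fun x => a *: T x).
Proof.
move=> [M M0 hM]; have a0 : 0 <= complex.Re (a * a^* ).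
  by rewrite -ler0c RRe_real ?mul_conjC_ge0// ger0_real// mul_conjC_ge0.
exists (complex.Re (a * a^* ) * M) => [|x]; first exact: mulr_ge0.
by rewrite sqnormZ -mulrA ler_wpM2l.
Qed.

Lemma bnd_comp S T : bnd S -> bnd T -> bnd (fun x => S (T x)).
Proof.
move=> [M M0 hM] [N N0 hN]; exists (M * N) => [|x]; first exact: mulr_ge0.
by rewrite (le_trans (hM _))// -mulrA ler_wpM2l.
Qed.

Lemma sym_idem_pythagoras P x : symm P -> (forall y, P (P y) = P y) ->
  ip x x = ip (P x) (P x) + ip (x - P x) (x - P x).
Proof.
move=> sP iP; rewrite -(@ip_orth_add (P x)) ?[P x + _]addrC ?subrK//.
by rewrite ipBr !sP iP subrr.
Qed.

(** Boundedness is automatic: by Pythagoras a symmetric idempotent is a contraction. *)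
Lemma orth_projP P :
  orth_proj ip P <-> [/\ lin P, symm P & forall x, P (P x) = P x].
Proof.
split=> [[/bounded_saP[l _ s] i]|[l s i]] //; split=> //.
apply/bounded_saP; split=> //; exists 1 => [|x]; rewrite ?ler01// mul1r.
rewrite -lecR -!sqnormE (sym_idem_pythagoras x s i) lerDl.
exact: ip_ge0.
Qed.

Lemma pr_orth_proj w : orthonormal w -> orth_proj ip (pr w).
Proof.
move=> ow; apply/orth_projP; split; [exact: pr_lin|exact: pr_sym|].
by move=> x; exact: pr_id.
Qed.

(** * Projection onto the closed span of an orthonormal sequence *)

Definition hcvg (u : nat -> V) (l : V) := forall e : R, 0 < e ->
  exists N, forall p, (N <= p)%N -> hnorm ip (u p - l) < e.

(** Cauchy-Schwarz bounds the squared modulus of [ip l y - k] by [sqnorm (u p - l) * sqnorm y] for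
    large [p]. *)
Lemma hcvg_ip_const u l y k N : hcvg u l ->
  (forall p, (N <= p)%N -> ip (u p) y = k) -> ip l y = k.
Proof.
move=> ul uk; apply/eqP; rewrite -subr_eq0 -normr_eq0 -sqrf_eq0 eq_sym.
rewrite eq_le exprn_ge0//=.
set c : R[i] := `|_| ^+ 2; have c0 : 0 <= c by rewrite exprn_ge0.
rewrite -(RRe_real (ger0_real c0)) -[0]/((0%:C)%C) lecR.
apply/ler_addgt0Pr => e e0; rewrite add0r.
(* The [+ 1] keeps the denominator positive when [y = 0]. *)
pose d := e / (sqnorm y + 1).
have y1 : 0 < sqnorm y + 1 by rewrite ltr_wpDl// sqnorm_ge0.
have d0 : 0 < d by rewrite divr_gt0.
have [|N' hN'] := ul (Num.sqrt d); first by rewrite sqrtr_gt0.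
have := hN' _ (leq_maxr N N').
rewrite hnorm_lt ?sqrtr_gt0// sqr_sqrtr ?(ltW d0)//.
set p := maxn N N' => /ltW hp.
have : c <= ip (u p - l) (u p - l) * ip y y.
  by rewrite (le_trans _ (cauchy_schwarz _ _))// /c ipBl uk ?leq_maxl// distrC.
rewrite -(@RRe_real _ c) ?ger0_real ?exprn_ge0// !sqnormE -rmorphM lecR.
move=> /le_trans; apply.
rewrite (@le_trans _ _ (d * (sqnorm y + 1)))//; last by rewrite divfK// gt_eqF.
by rewrite ler_pM ?sqnorm_ge0// lerDl.
Qed.

Lemma nondecreasing_bounded_cauchy (f : nat -> R) (B : R) :
  (forall p q, (p <= q)%N -> f p <= f q) -> (forall p, f p <= B) ->
  forall e, 0 < e -> exists N, forall p, (N <= p)%N -> f p < f N + e.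
Proof.
move=> fm fB e e0; have hs : has_sup (range f).
  split; first by exists (f 0%N), 0%N.
  by exists B => _ [p _ <-].
have [_ [N _ <-] hN] := sup_adherent e0 hs.
exists N => p _; rewrite -ltrBlDr (le_lt_trans _ hN)// lerB//.
by apply: (ub_le_sup hs.2); exists p.
Qed.

Lemma orthonormal_mkseq (e : nat -> V) N :
  (forall i j, ip (e i) (e j) = (i == j)%:R) -> orthonormal (mkseq e N).
Proof.
move=> he; have inj : injective e.
  move=> i j eij; have := he i j; rewrite eij he eqxx.
  by case: eqP => // _ /eqP; rewrite oner_eq0.
split; first by rewrite mkseq_uniq.
by move=> u v /mapP[i _ ->] /mapP[j _ ->]; rewrite he (inj_eq inj).
Qed.

(* Membership in the closed span is expressed as membership in the double
   orthogonal complement. *)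
Lemma closed_span_decomposition (e : nat -> V) x : hcomplete ip ->
  (forall i j, ip (e i) (e j) = (i == j)%:R) ->
  exists p, (forall i, ip (x - p) (e i) = 0) /\
            (forall y, (forall i, ip y (e i) = 0) -> ip p y = 0).
Proof.
move=> hc he; pose w N := mkseq e N; have ow N := orthonormal_mkseq N he.
have wP N v : reflect (exists2 i, (i < N)%N & v = e i) (v \in w N).
  by apply: (iffP mapP) => -[k]; rewrite ?mem_iota => kN ->; exists k;
    rewrite ?mem_iota.
have w_mono p q v : (p <= q)%N -> v \in w p -> v \in w q.
  move=> pq /wP[i ip' ->]; apply/wP; exists i => //.
  exact: leq_trans ip' pq.
pose S N := pr (w N) x.
have SS p q : (q <= p)%N -> ip (S p) (S q) = ip (S q) (S q).
  move=> qp; rewrite /S pr_sym pr_sym; congr (ip x _); rewrite pr_id//.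
  rewrite pr_span//; apply: in_span_trans (pr_in_span (w q) x) => v vq.
  exact/in_span_mem/(w_mono _ _ _ qp).
(* Since the squared norms of the partial sums increase and are bounded by [sqnorm x], this identity
   makes [S] a Cauchy sequence. *)
have dS p q : (q <= p)%N -> sqnorm (S p - S q) = sqnorm (S p) - sqnorm (S q).
  move=> qp; apply/(fmorph_inj (@real_complex R)).
  rewrite rmorphB /= -!sqnormE ipBl !ipBr SS//.
  by rewrite (inner_conj_sym ip (S p) (S q)) SS// -inner_conj_sym subrr subr0.
have Sm p q : (p <= q)%N -> sqnorm (S p) <= sqnorm (S q).
  by move=> pq; rewrite -subr_ge0 -dS// sqnorm_ge0.
have SB p : sqnorm (S p) <= sqnorm x.
  rewrite -lecR -!sqnormE (@sym_idem_pythagoras (pr (w p)) x) ?lerDl ?ip_ge0//.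
    exact: pr_sym.
  by move=> y; exact: pr_id.
have SC := nondecreasing_bounded_cauchy Sm SB.
have [d d0|l Sl] := hc S.
  have [|N hN] := SC (d ^+ 2); first exact: exprn_gt0.
  exists N => p q Np Nq; rewrite hnorm_lt//.
  wlog qp : p q Np Nq / (q <= p)%N => [hw|].
    have [|/ltnW] := leqP q p; first exact: hw.
    by move=> /hw; rewrite -(opprB (S p)) /sqnorm ipNl ipNr opprK; apply.
  by rewrite dS// ltrBlDr addrC (lt_le_trans (hN _ Np))// lerD2r Sm.
exists l; split=> [i|y hy].
  rewrite ipBl (@hcvg_ip_const S l (e i) (ip x (e i)) i.+1) ?subrr// => p ip'.
  by rewrite /S pr_sym pr_mem//; apply/wP; exists i.
apply: (@hcvg_ip_const S l y 0 0) => // p _; apply: ip_eq0C.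
apply: ip_span0 (pr_in_span (w p) x) => _ /wP[i _ ->]; exact: hy.
Qed.

Lemma closed_span_proj (e : nat -> V) : hcomplete ip ->
  (forall i j, ip (e i) (e j) = (i == j)%:R) ->
  exists P, [/\ orth_proj ip P, forall i, P (e i) = e i,
    forall z, (forall i, ip z (e i) = 0) -> P z = 0
    & forall x y, (forall i, ip y (e i) = 0) -> ip (P x) y = 0].
Proof.
move=> hc he.
have /choice[P hP] := fun x => @closed_span_decomposition e x hc he.
(* The decomposition is unique, as [P x - z] is orthogonal to every [e i] and hence to itself.
   Linearity, idempotence and the values of [P] all follow from this. *)
have uniqP x z : (forall i, ip (x - z) (e i) = 0) ->
    (forall y, (forall i, ip y (e i) = 0) -> ip z y = 0) -> P x = z.
  move=> xz zo; apply/subr0_eq/(@ip_eq0 (P x - z)).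
  have h i : ip (P x - z) (e i) = 0.
    rewrite (_ : P x - z = (x - z) - (x - P x)); last first.
      by rewrite opprB [RHS]addrC subrKA.
    by rewrite ipBl xz (hP x).1 subrr.
  by rewrite {1}ipBl (hP x).2// zo// subrr.
have lP : lin P.
  move=> a x y; apply: uniqP => [i|z hz].
    rewrite (_ : _ - _ = a *: (x - P x) + (y - P y)); last first.
      by rewrite scalerBr opprD addrACA.
    by rewrite ipDl ipZl (hP x).1 (hP y).1 mulr0 addr0.
  by rewrite ipDl ipZl (hP x).2// (hP y).2// mulr0 addr0.
have iP x : P (P x) = P x.
  by apply: uniqP => [i|y]; [rewrite subrr ip0l|exact: (hP x).2].
have PP x y : ip (P x) y = ip (P x) (P y).
  by apply: subr0_eq; rewrite -ipBr (hP x).2//; exact: (hP y).1.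
exists P; split.
- apply/orth_projP; split=> // x y.
  by rewrite PP inner_conj_sym -PP -inner_conj_sym.
- move=> i; apply: uniqP => [j|y hy]; first by rewrite subrr ip0l.
  by apply: ip_eq0C; apply: hy.
- move=> z hz; apply: uniqP => [i|y _]; last by rewrite ip0l.
  by rewrite subr0.
- by move=> x y; exact: (hP x).2.
Qed.

(** * Numerical ranges and finite-rank perturbations *)

Section NumericalRange.
Variables (m : nat) (A : 'I_m -> V -> V) (a : 'I_m -> R).

(** By symmetry [ip (F y) (F y) = ip y (F (F y))], and [F (F y)] lies in the span of [s]. *)
Lemma finite_rank_symm_kernel F s y : symm F -> (forall x, in_span s (F x)) ->
  (forall z, z \in s -> ip y z = 0) -> F y = 0.
Proof.
by move=> sF Fs ys; apply/(@ip_eq0 (F y)); rewrite sF (ip_span0 ys).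
Qed.

Lemma Lambda_inf_tuple_add (F : 'I_m -> V -> V) : sa_finite_rank_tuple ip F ->
  Lambda_inf ip A a -> Lambda_inf ip (tuple_add A F) a.
Proof.
move=> hF [P [/orth_projP[lP sP iP] infP cP]].
have /fin_all_exists[sF hs] := fun j => (hF j).2.
pose s := flatten (codom sF).
have [x|w [ow wP ws]] := @gram_schmidt P (map P s) lP.
  by move=> /mapP[z _ ->].
have prP x : pr w (P x) = pr w x.
  by apply: eq_big_seq => v vw; rewrite sP wP.
have Ppr x : P (pr w x) = pr w x.
  rewrite (lin_sum _ _ lP); apply: eq_big_seq => v vw.
  by rewrite (linZ lP) (wP v).
(* [Q] projects onto the part of the range of [P] orthogonal to all [P z] with [z] in [s]. There
   [ip (Q x) z = ip (Q x) (P z) = 0], so each [F j] vanishes on it. *)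
pose Q x := P x - pr w x.
have QP x : Q (P x) = Q x by rewrite /Q iP prP.
have PQ x : P (Q x) = Q x by rewrite /Q (linB lP) iP Ppr.
have prQ x : pr w (Q x) = 0.
  by rewrite /Q (linB (@pr_lin w)) prP pr_id// subrr.
have QQ x : Q (Q x) = Q x by rewrite {1}/Q PQ prQ subr0.
have lQ : lin Q.
  by move=> c x y; rewrite /Q lP (@pr_lin w) scalerBr opprD addrACA.
have FQ j x : F j (Q x) = 0.
  have [/bounded_saP[_ _ symF] _] := hF j.
  apply: (finite_rank_symm_kernel symF (hs j)) => z zs.
  have Pz : in_span w (P z).
    by apply/ws/map_f/flattenP; exists (sF j) => //; exact: codom_f.
  by rewrite -PQ sP -(pr_span ow Pz) -pr_sym prQ ip0l.
exists Q; split.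
- apply/orth_projP; split=> // x y.
  by rewrite /Q ipBl ipBr sP pr_sym.
- move=> r; have [x hx] := infP (r ++ w); exists x => hQ; apply: hx.
  rewrite -(subrK (pr w x) (P x)); apply: in_spanD.
    exact: in_span_catl.
  exact/in_span_catr/pr_in_span.
- move=> j x; rewrite /tuple_add FQ addr0 -QP -{1}(PQ x) cP (linZ lQ).
  by rewrite PQ QQ.
Qed.

Lemma infinite_range_orthonormal P k : orth_proj ip P -> infinite_range P ->
  exists w, [/\ size w = k, orthonormal w & forall v, v \in w -> P v = v].
Proof.
move=> /orth_projP[lP sP iP] infP; elim: k => [|k [w [sw ow wP]]].
  by exists [::]; split.
have [x hx] := infP w; have Ppr : P (pr w (P x)) = pr w (P x).
  rewrite (lin_sum _ _ lP); apply: eq_big_seq => v vw.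
  by rewrite (linZ lP) (wP v).
have y0 : P x - pr w (P x) != 0.
  apply/eqP => /subr0_eq h; apply: hx; rewrite h; exact: pr_in_span.
have [c _ oe] :=
  orthonormal_extend ow y0 (fun v => @pr_residual_orth w (P x) v ow).
exists (c *: (P x - pr w (P x)) :: w); split=> //=; first by rewrite sw.
move=> v; rewrite inE => /predU1P[->|/wP//].
by rewrite (linZ lP) (linB lP) iP Ppr.
Qed.

Lemma Lambda_inf_Lambda k : Lambda_inf ip A a -> Lambda ip k A a.
Proof.
move=> [P [oP infP cP]].
have [w [sw ow wP]] := infinite_range_orthonormal k oP infP.
have /orth_projP[lP sP iP] := oP.
exists (pr w); split; first exact: pr_orth_proj.
  exists w; split=> // [i j ik jk|i ik|x]; last exact: pr_in_span.
    by case: ow => uw ow; rewrite ow ?mem_nth ?sw// nth_uniq ?sw.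
  by rewrite pr_mem// mem_nth ?sw.
have Ppr x : P (pr w x) = pr w x.
  rewrite (lin_sum _ _ lP); apply: eq_big_seq => v vw.
  by rewrite (linZ lP) (wP v).
(* Coefficients are compared along each [v] in [w]: since [P] fixes [v] and [pr w x], they can be
   computed with [P (A j (P _))] in place of [A j]. *)
move=> j x; rewrite -(pr_id x ow) {1}/pr -(linZ (@pr_lin w)).
apply: eq_big_seq => v vw; congr (_ *: _).
by rewrite -{1}(wP v vw) -sP pr_id// -{1}Ppr cP Ppr.
Qed.

Hypothesis HA : forall j, bounded_sa ip (A j).

Let lA j : lin (A j). Proof. by have /bounded_saP[] := HA j. Qed.
Let sA j : symm (A j). Proof. by have /bounded_saP[] := HA j. Qed.

(** Any unit vector [z] in the range of [P] works, as [ip (B j z) z = ip (P (B j (P z))) z];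
    positivity of [n] provides one. *)
Lemma Lambda_witness n (B : 'I_m -> V -> V) : (0 < n)%N -> Lambda ip n B a ->
  exists2 z, ip z z = 1 & forall j, ip (B j z) z = ((a j)%:C)%C.
Proof.
move=> n0 [P [/orth_projP[lP sP iP] [e [se oe eP _]] cP]].
have zz : ip e`_0 e`_0 = 1 by rewrite oe.
exists e`_0 => // j; rewrite -{1 2}(eP 0%N n0) -{1}sP.
by rewrite cP ipZl eP// zz mulr1.
Qed.

(** With [p = pr w] and [q = id - p], adding this tuple to [A] yields [c p + q A q]. *)
Lemma compression_perturbation w (c : 'I_m -> R) : orthonormal w ->
  sa_finite_rank_tuple ip (fun j x => ((c j)%:C)%C *: pr w x - A j x
    + (A j (x - pr w x) - pr w (A j (x - pr w x)))).
Proof.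
move=> ow j; have /bounded_saP[_ bA _] := HA j.
have /bounded_saP[_ bp _] := (pr_orth_proj ow).1.
have lp := @pr_lin w.
pose q x := x - pr w x.
have lq : lin q by move=> d x y; rewrite /q lp scalerBr opprD addrACA.
have bN T : bnd T -> bnd (fun x => - T x).
  move=> /(bndZ (-1)); congr bnd; apply/funext => x; exact: scaleN1r.
have b1 : bnd id by exists 1 => // x; rewrite mul1r.
have bq : bnd q by apply: (bndD b1 (bN _ bp)).
split.
  apply/bounded_saP; split.
  - apply: (lin_add (lin_add (lin_scale _ lp) (lin_opp (@lA j)))).
    by move=> d x y; rewrite -!/(q _) lq lA lq.
  - apply: bndD.
      by apply: bndD; [exact: bndZ|exact: bN].
    exact: (bnd_comp bq (bnd_comp bA bq)).
  - move=> x y.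
    rewrite ipDl ipBl ipDr ipBr ipZl ipZr sA pr_sym.
    congr (_ - _ + _); first by rewrite conj_Creal// complex_real.
    have sq u v : ip (q u) v = ip u (q v) by rewrite /q ipBl ipBr pr_sym.
    by rewrite -!/(q _) sq sA sq.
(* The perturbation equals [c p - A p - p A q], whose values lie in the span of [w] and its image
   under [A j]. *)
exists (w ++ map (A j) w) => x.
have hp y : in_span (w ++ map (A j) w) (pr w y).
  exact/in_span_catl/pr_in_span.
have hAp : in_span (w ++ map (A j) w) (A j (pr w x)).
  apply: in_span_catr; rewrite (lin_sum _ _ (lA j)).
  apply: in_span_sum => v vw; rewrite (linZ (lA j)).
  by apply/in_spanZ/in_span_mem/map_f.
rewrite [X in in_span _ X](_ : _ = ((c j)%:C)%C *: pr w x
  + (-1 *: A j (pr w x) + -1 *: pr w (A j (x - pr w x)))).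
  by do !apply: in_spanD; apply: in_spanZ.
by rewrite !scaleN1r (linB (lA j)) -!addrA; congr (_ + _); rewrite addKr.
Qed.

(** * From all perturbations to an infinite-rank compression *)

Section AllPerturbations.
Variables (n : nat) (n_gt0 : (0 < n)%N).
Hypothesis HF : forall F : 'I_m -> V -> V, sa_finite_rank_tuple ip F ->
  Lambda ip n (tuple_add A F) a.

(* Compressing [A] to the complement of [s] and putting the scalar [a - d] on
   the span of [s] is a finite-rank perturbation; a unit vector of value [a]
   for it has a component off [s] whose value lies on the ray from [a] in
   direction [d]. *)
Lemma ray_vector s (d : 'I_m -> R) : (exists j, d j != 0) ->
  exists x t, [/\ x != 0, 0 <= t, forall y, y \in s -> ip x y = 0
    & forall j, ip (A j x) x = ((a j)%:C * ip x x + t * (d j)%:C)%C].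
Proof.
move=> [j0 dj0].
have [//|w [ow _ ws]] := @gram_schmidt id s (fun _ _ _ => erefl).
have [z zz hz] := Lambda_witness n_gt0
  (HF (compression_perturbation (fun j => a j - d j) ow)).
pose u := z - pr w z; pose t := ip (pr w z) (pr w z).
have uu : ip z z = t + ip u u.
  by apply: sym_idem_pythagoras; [exact: pr_sym|move=> y; exact: pr_id].
have pu : pr w u = 0 by rewrite (linB (@pr_lin w)) pr_id// subrr.
(* The value at [z] reads [(a - d) t + ip (A j u) u = a], where [1 = t + ip u u]. *)
have hu j : ip (A j u) u = ((a j)%:C * ip u u + t * (d j)%:C)%C.
  have := hz j; rewrite /tuple_add addrA [A j z + (_ - _)]addrC subrK.
  rewrite -/u ipDl ipZl -{1}(pr_id z ow) pr_sym -/t.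
  have -> : ip (A j u - pr w (A j u)) z = ip (A j u) u.
    by rewrite ipBl pr_sym -ipBr.
  have -> : ip u u = 1 - t by rewrite -zz uu addrC addKr.
  rewrite rmorphB /= => h.
  by apply: (addrI (((a j)%:C - (d j)%:C)%C * t)); rewrite h; ring.
exists u, t; split=> //; [|exact: ip_ge0|]; last first.
  by move=> y /ws; apply: ip_span0 => v; exact: pr_residual_orth.
(* If [u = 0] then [t = 1], and the formula forces [d j0 = 0]. *)
apply/eqP => u0; have := hu j0; rewrite u0 !ip0r mulr0 add0r.
have -> : t = 1 by rewrite -zz uu u0 ip0l addr0.
move=> /esym/eqP; rewrite mul1r => /eqP/complexI/eqP.
by rewrite (negbTE dj0).
Qed.

(** The homogeneous form of the value allows [x] to be rescaled freely and normalised only at the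
    end. *)
Definition attained_off s := exists x,
  [/\ x != 0, forall y, y \in s -> ip x y = 0
  & forall j, ip (A j x) x = ((a j)%:C)%C * ip x x].

(* Orthogonal and [A]-orthogonal vectors have additive values, so rays can be
   followed one after the other, each rescaled to displacement exactly [d]. *)
Lemma attained_off_or_displaced (l : seq ('I_m -> R)) s :
  (forall d, List.In d l -> exists j, d j != 0) ->
  attained_off s \/ exists x, [/\ (0 < size l)%N -> x != 0,
    forall y, y \in s -> ip x y = 0
    & forall j, ip (A j x) x
        = ((a j)%:C)%C * ip x x + \sum_(d <- l) ((d j)%:C)%C].
Proof.
elim: l s => [|d l IH] s hl.
  (* The zero vector serves for the empty list, hence the guard on [x != 0]. *)
  right; exists 0; split=> // [y _|j]; rewrite ?ip0l//.
  by rewrite ip0r mulr0 big_nil addr0.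
have [x [t [x0 t0 xs hx]]] := ray_vector s (hl d (or_introl erefl)).
(* Without displacement, [x] itself already attains [a]. *)
have [tE|tn0] := eqVneq t 0.
  by left; exists x; split=> // j; rewrite hx tE mul0r addr0.
have t_gt0 : 0 < t by rewrite lt_neqAle eq_sym tn0.
pose c := (sqrtC t)^-1; have c0 : 0 < c by rewrite invr_gt0 sqrtC_gt0.
have ccJ : c * c^* * t = 1.
  by rewrite conj_Creal ?gtr0_real// -expr2 exprVn sqrtCK mulVf.
pose u := c *: x.
(* Avoiding [u] and every [A j u] kills the cross terms in the value at [u + y]. *)
have [e he|[y [ys yx hy]]|[y [_ ys hy]]] :=
    IH (s ++ u :: [seq A j u | j <- enum 'I_m]).
- by apply: hl; right.
- by left; exists y; split=> // z zs; apply: yx; rewrite mem_cat zs.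
right; exists (u + y).
have yu : ip y u = 0 by apply: ys; rewrite mem_cat mem_head orbT.
have yAu j : ip y (A j u) = 0.
  apply: ys; rewrite mem_cat inE; apply/orP; right; apply/orP; right.
  by apply: map_f; rewrite mem_enum.
have uy := ip_eq0C yu.
split=> [_|z zs|j].
- apply/eqP => /(congr1 (fun z => ip z u)); rewrite ipDl yu addr0 ip0l.
  move=> /ip_eq0/eqP; rewrite scaler_eq0 (negbTE x0) orbF.
  by rewrite gt_eqF.
- by rewrite ipDl ipZl xs// mulr0 add0r ys// mem_cat zs.
- rewrite (linD (@lA j)) ip_orth_add// big_cons ipDl !ipDr.
  rewrite (sA j y u) yAu (ip_eq0C (yAu j)) hy addr0 add0r.
  have -> : ip (A j u) u = ((a j)%:C * ip u u + (d j)%:C)%C.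
    rewrite (linZ (@lA j)) !(ipZl, ipZr) hx.
    by rewrite -[X in _ = _ + X]mul1r -ccJ; ring.
  by ring.
Qed.

Lemma attained_off_all s : (0 < m)%N -> attained_off s.
Proof.
(* These directions sum to zero in each coordinate; [0 < m] makes the constant tuple nonzero. *)
move=> m_gt0; pose l : seq ('I_m -> R) :=
  (fun=> -1) :: [seq (fun j => (j == i)%:R) | i <- enum 'I_m].
have [d [<-|/List.in_map_iff[i [<- _]]]|//|[x [x0 xs hx]]] :=
    @attained_off_or_displaced l s.
- by exists (Ordinal m_gt0); rewrite oppr_eq0 oner_eq0.
- by exists i; rewrite eqxx oner_eq0.
exists x; split=> // [|j]; first exact: x0.
rewrite hx big_cons big_map big_enum /= (bigD1 j)//= eqxx big1 => [|i ij].
  by rewrite rmorphN rmorph1 addr0 addNr addr0.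
by rewrite eq_sym (negbTE ij).
Qed.

Lemma attained_off_unit s : (0 < m)%N -> exists x, [/\ ip x x = 1,
  forall y, y \in s -> ip x y = 0 & forall j, ip (A j x) x = ((a j)%:C)%C].
Proof.
move=> /(attained_off_all s)[x [x0 xs hx]]; have [c [_ cx]] := normalize x0.
exists (c *: x); split=> [|y ys|j]; first by rewrite ipZl ipZr mulrA.
  by rewrite ipZl xs// mulr0.
by rewrite (linZ (@lA j)) ipZl ipZr hx -[RHS]mulr1 -cx; ring.
Qed.

Lemma orthonormal_diagonalizing_sequence : (0 < m)%N -> exists e : nat -> V,
  (forall i k, ip (e i) (e k) = (i == k)%:R) /\
  (forall j i k, ip (A j (e i)) (e k) = ((a j)%:C)%C * (i == k)%:R).
Proof.
move=> m_gt0; have /choice[g hg] := fun s => attained_off_unit s m_gt0.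
(* [L k] collects all [e i] and [A j (e i)] with [i < k], so [e k] is orthogonal to them; symmetry
   of [A j] covers the reversed indices. *)
pose step s := s ++ g s :: [seq A j (g s) | j <- enum 'I_m].
pose L k := iter k step [::]; pose e k := g (L k).
have L_mono i k x : (i <= k)%N -> x \in L i -> x \in L k.
  move=> /subnK <-; elim: (k - i)%N => // p IH /IH h.
  by rewrite addSn /L iterS -/(L _) mem_cat h.
have eL i k : (i < k)%N -> e i \in L k.
  by move=> /L_mono; apply; rewrite /L iterS mem_cat mem_head orbT.
have AeL j i k : (i < k)%N -> A j (e i) \in L k.
  move=> /L_mono; apply; rewrite /L iterS mem_cat inE.
  by rewrite [X in _ || (_ || X)]map_f ?mem_enum// !orbT.
have orth i k : (i < k)%N -> ip (e k) (e i) = 0.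
  by move=> /eL; case: (hg (L k)) => _ h _; exact: h.
have Aorth j i k : (i < k)%N -> ip (e k) (A j (e i)) = 0.
  by move=> /(AeL j); case: (hg (L k)) => _ h _; exact: h.
exists e; split=> [i k|j i k].
  case: (ltngtP i k) => [/orth/ip_eq0C//|/orth//|->].
  by case: (hg (L k)).
case: (ltngtP i k) => [/Aorth h|/Aorth h|->].
- by rewrite (ip_eq0C (h j)) mulr0.
- by rewrite sA h mulr0.
- by case: (hg (L k)) => _ _ ->; rewrite mulr1.
Qed.

Lemma Lambda_inf_of_perturbations :
  hcomplete ip -> (0 < m)%N -> Lambda_inf ip A a.
Proof.
move=> hc /orthonormal_diagonalizing_sequence[e [he hA]].
have [P [oP Pe P0 Porth]] := closed_span_proj hc he.
have /orth_projP[lP sP iP] := oP.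
exists P; split=> // [s|j x].
  (* Otherwise the first [(size s).+1] vectors [e i], all fixed by [P], would lie in the span of
     [s]. *)
  apply/existsNP => /= hs.
  have := @orthonormal_size_le _ s (orthonormal_mkseq (size s).+1 he).
  rewrite size_mkseq ltnn => h; suff: false by [].
  by apply: h => _ /mapP[i _ ->]; rewrite -Pe; exact: hs.
(* It suffices that [A j (P x) - a P x] is orthogonal to each [e i]. By symmetry this pairs [P x]
   with [A j (e i) - a e i], which is orthogonal to every [e k]. *)
apply: subr0_eq; rewrite -{2}(iP x) -(linZ lP) -(linB lP).
apply: P0 => i; rewrite ipBl ipZl sA.
have /Porth-/(_ x) : forall k, ip (A j (e i) - ((a j)%:C)%C *: e i) (e k) = 0.
  by move=> k; rewrite ipBl ipZl hA he subrr.
by rewrite ipBr ipZr conj_Creal ?complex_real.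
Qed.

End AllPerturbations.
End NumericalRange.

(** Perturbing [A + F0] by [- F0] gives the converse inclusion between (a) and (b). *)
Lemma sa_finite_rank_tuple_opp m (F : 'I_m -> V -> V) :
  sa_finite_rank_tuple ip F -> sa_finite_rank_tuple ip (fun j x => - F j x).
Proof.
move=> hF j; have [/bounded_saP[l b s] [r hr]] := hF j; split.
  apply/bounded_saP; split=> [|| x y]; last by rewrite ipNl ipNr s.
    exact: lin_opp.
  have := bndZ (-1) b; congr bnd; apply/funext => x; exact: scaleN1r.
by exists r => x; rewrite -scaleN1r; apply/in_spanZ/hr.
Qed.

Lemma tuple_addK m (A F : 'I_m -> V -> V) :
  tuple_add (tuple_add A F) (fun j x => - F j x) = A.
Proof. by apply/funext => j; apply/funext => x; exact: addrK. Qed.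

End InnerProduct.

Theorem theorem4p3 (R : realType) (V : lmodType R[i]) (ip : inner_product V)
  (Hcomplete : hcomplete ip) (Hinf : infinite_dim V)
  (m : nat) (hm : (0 < m)%N) (A : 'I_m -> V -> V)
  (HA : forall j : 'I_m, bounded_sa ip (A j))
  (n : nat) (hn : (1 <= n)%N)
  (F0 : 'I_m -> V -> V) (HF0 : sa_finite_rank_tuple ip F0) :
  forall a : 'I_m -> R,
  [/\ Lambda_inf ip A a <-> Lambda_inf ip (tuple_add A F0) a,
      Lambda_inf ip A a <->
        (forall F : 'I_m -> V -> V, sa_finite_rank_tuple ip F ->
           Lambda ip n (tuple_add A F) a)
    & Lambda_inf ip A a <->
        (forall k : nat, (1 <= k)%N ->
          forall F : 'I_m -> V -> V, sa_finite_rank_tuple ip F ->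
           Lambda ip k (tuple_add A F) a)].
Proof.
move=> a; split.
- split; first exact: Lambda_inf_tuple_add.
  move=> /(Lambda_inf_tuple_add (sa_finite_rank_tuple_opp HF0)).
  by rewrite tuple_addK.
- split=> [h F hF|h]; last exact: (Lambda_inf_of_perturbations HA hn h).
  exact/Lambda_inf_Lambda/Lambda_inf_tuple_add.
- split=> [h k _ F hF|h]; first exact/Lambda_inf_Lambda/Lambda_inf_tuple_add.
  (* Specialising the rank to [n] reduces (d) to (c). *)
  exact: (Lambda_inf_of_perturbations HA hn (h n hn)).
Qed.
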